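(* Let $t$ and $k$ be integers with $t\geq k\geq 1$, and let $G$ be a $t$-connected graph of order $n\geq\frac{15t-11k+29}{2}$, where $n\equiv k \pmod 2$. If $$e(G)>\binom{n+k-t-2}{2}+(t-k+2)(t+1),$$ then $G$ is $k$-factor-critical unless $\mathcal{C}_{n+k-1}(G)\cong K_{t}\vee (K_{n+k-2t-1}+(t-k+1)K_{1})$.
   Context: All graphs are finite, simple and undirected. The order of a graph is its number of vertices, and $e(G)$ is the number of edges of $G$; $d_G(v)$ denotes the degree of vertex $v$ in $G$. A connected graph is called $t$-connected if it has more than $t$ vertices and remains connected whenever fewer than $t$ vertices are removed. A graph $G$ is $k$-factor-critical if $G-S$ has a perfect matching for every $S\subseteq V(G)$ with $|S|=k$. For an integer $l\geq 0$, the $l$-closure $\mathcal{C}_{l}(G)$ of $G$ is the graph obtained from $G$ by successively joining pairs of nonadjacent vertices whose degree sum (in the current graph) is at least $l$, until no such pair exists. $K_m$ is the complete graph on $m$ vertices; $G+H$ is the disjoint union of vertex-disjoint graphs $G$ and $H$; $sG$ is the disjoint union of $s$ copies of $G$; the join $G\vee H$ is obtained from $G+H$ by adding all edges between $V(G)$ and $V(H)$. *)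

(* Defs.v *)
From mathcomp Require Import all_boot.
Set Implicit Arguments.
Unset Strict Implicit.
Unset Printing Implicit Defensive.

Record sgraph (V : finType) := SGraph {
  adj :> rel V;
  adj_sym : symmetric adj;
  adj_irr : irreflexive adj
}.

Definition edges (V : finType) (G : sgraph V) : {set {set V}} :=
  [set e | [exists x, exists y, G x y && (e == [set x; y])]].

Definition num_edges (V : finType) (G : sgraph V) : nat := #|edges G|.

Definition degree (V : finType) (G : sgraph V) (v : V) : nat :=
  #|[set w | G v w]|.

Section Delete.
Variables (V : finType) (G : sgraph V) (S : {set V}).

Definition delete_rel : rel {x : V | x \notin S} :=
  fun x y => G (val x) (val y).

Fact delete_sym : symmetric delete_rel.
Proof. by move=> x y; apply: adj_sym. Qed.

Fact delete_irr : irreflexive delete_rel.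
Proof. by move=> x; apply: adj_irr. Qed.

Definition delete : sgraph {x : V | x \notin S} :=
  SGraph delete_sym delete_irr.
End Delete.

Definition connected_graph (V : finType) (G : sgraph V) : Prop :=
  0 < #|V| /\ forall x y : V, connect G x y.

Definition t_connected (t : nat) (V : finType) (G : sgraph V) : Prop :=
  [/\ connected_graph G, t < #|V| &
      forall S : {set V}, #|S| < t -> connected_graph (delete G S)].

(* [partition] says that the edges of M are pairwise disjoint and cover V. *)
Definition perfect_matching (V : finType) (G : sgraph V) (M : {set {set V}}) :=
  (M \subset edges G) && partition M [set: V].

Definition factor_critical (k : nat) (V : finType) (G : sgraph V) : Prop :=
  forall S : {set V}, #|S| = k ->
    exists M, perfect_matching (delete G S) M.

Section Complete.
Variable m : nat.

Definition complete_rel : rel 'I_m := fun x y => x != y.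

Fact complete_sym : symmetric complete_rel.
Proof. by move=> x y; rewrite /complete_rel eq_sym. Qed.

Fact complete_irr : irreflexive complete_rel.
Proof. by move=> x; rewrite /complete_rel eqxx. Qed.

Definition complete : sgraph 'I_m := SGraph complete_sym complete_irr.
End Complete.

Section Sums.
Variables (U V : finType) (G : sgraph U) (H : sgraph V).

(* The Boolean b tells whether the two sides are completely joined. *)
Definition sum_rel (b : bool) : rel (U + V)%type := fun x y =>
  match x, y with
  | inl u, inl u' => G u u'
  | inr v, inr v' => H v v'
  | _, _ => b
  end.

Fact sum_sym b : symmetric (sum_rel b).
Proof. by case=> x [] y //=; apply: adj_sym. Qed.

Fact sum_irr b : irreflexive (sum_rel b).
Proof. by case=> x /=; apply: adj_irr. Qed.

Definition disjoint_union : sgraph (U + V)%type :=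
  SGraph (sum_sym false) (sum_irr false).

Definition graph_join : sgraph (U + V)%type :=
  SGraph (sum_sym true) (sum_irr true).
End Sums.

Section Copies.
Variables (s : nat) (V : finType) (G : sgraph V).

Definition copies_rel : rel ('I_s * V)%type :=
  fun x y => (x.1 == y.1) && G x.2 y.2.

Fact copies_sym : symmetric copies_rel.
Proof. by move=> x y; rewrite /copies_rel eq_sym adj_sym. Qed.

Fact copies_irr : irreflexive copies_rel.
Proof. by move=> x; rewrite /copies_rel adj_irr andbF. Qed.

Definition copies : sgraph ('I_s * V)%type := SGraph copies_sym copies_irr.
End Copies.

Definition isomorphic (U V : finType) (G : sgraph U) (H : sgraph V) : Prop :=
  exists2 f : U -> V, bijective f & forall x y, H (f x) (f y) = G x y.

Section AddEdge.
Variables (V : finType) (G : sgraph V) (x y : V).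

Definition add_edge_rel : rel V := fun u v =>
  G u v || (u != v) && ([set u; v] == [set x; y]).

Fact add_edge_sym : symmetric add_edge_rel.
Proof. by move=> u v; rewrite /add_edge_rel adj_sym eq_sym setUC. Qed.

Fact add_edge_irr : irreflexive add_edge_rel.
Proof. by move=> u; rewrite /add_edge_rel adj_irr eqxx. Qed.

Definition add_edge : sgraph V := SGraph add_edge_sym add_edge_irr.
End AddEdge.

Section Closure.
Variables (V : finType) (l : nat).
Implicit Types F G H : sgraph V.

Definition joinable G (x y : V) : bool :=
  [&& x != y, ~~ G x y & l <= degree G x + degree G y].

Definition closure_step G : sgraph V :=
  if [pick p : V * V | joinable G p.1 p.2] is Some p
  then add_edge G p.1 p.2 else G.

(* At most #|V| ^ 2 joins are possible. The lemmas below show that the process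
   has then stopped, and that the order of the joins does not matter. *)
Definition degree_closure G : sgraph V := iter (#|V| ^ 2) closure_step G.

Inductive joins_to : sgraph V -> sgraph V -> Prop :=
  | JoinsNone G : joins_to G G
  | JoinsStep G x y H :
      joinable G x y -> joins_to (add_edge G x y) H -> joins_to G H.

Definition no_joinable G : Prop := forall x y, ~~ joinable G x y.

Lemma joins_to_closure G : joins_to G (degree_closure G).
Proof.
rewrite /degree_closure; elim: (_ ^ _) G => [|m IHm] G; first exact: JoinsNone.
rewrite iterSr {2}/closure_step; case: pickP => [p Hp | _]; last exact: IHm.
exact: JoinsStep Hp (IHm _).
Qed.

Lemma no_joinable_closure G : no_joinable (degree_closure G).
Proof.
pose A F := [set p : V * V | F p.1 p.2].
have inv m : no_joinable (iter m closure_step G)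
             \/ m <= #|A (iter m closure_step G)|.
  elim: m => [|m IHm]; first by right.
  rewrite iterS; move: (iter m _ G) IHm => F IHm; rewrite /closure_step.
  case: pickP => [[x y] /= Hp | noF]; last by left=> x y; rewrite (noF (x, y)).
  case: IHm => [/(_ x y)|IHm]; first by rewrite Hp.
  right; apply: leq_ltn_trans IHm _; apply: proper_card; apply/properP.
  have [nxy nFxy _] := and3P Hp; split.
    by apply/subsetP=> p; rewrite !inE /= /add_edge_rel => ->.
  by exists (x, y); rewrite !inE //= /add_edge_rel nxy eqxx orbT.
case: (inv (#|V| ^ 2)) => //; rewrite -/(degree_closure G) -mulnn -card_prod => leA.
move=> x y; apply/negP => /and3P[_ /negP[]].
have /eqP AT : A (degree_closure G) == setT by rewrite eqEcard subsetT cardsT.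
by have := in_setT (x, y); rewrite -AT inE.
Qed.

Lemma joins_to_sub G H : joins_to G H -> subrel G H.
Proof.
elim=> [F|F x y F' _ _ IH] u v Fuv //.
by apply: IH; rewrite /= /add_edge_rel Fuv.
Qed.

Lemma joins_to_min G H F :
  joins_to G H -> no_joinable F -> subrel G F -> subrel H F.
Proof.
move=> GH noF; elim: GH => [//|{}G x y {}H Gxy _ IH] GF; apply: IH.
have Fxy : F x y.
  have [nxy _ lxy] := and3P Gxy; apply: contraR (noF x y) => nFxy.
  rewrite /joinable nxy nFxy (leq_trans lxy) //.
  by apply: leq_add; apply: subset_leq_card; apply/subsetP=> z;
    rewrite !inE; apply: GF.
move=> u v /orP[/GF //|/andP[nuv /eqP Euv]].
have : u \in [set x; y] by rewrite -Euv set21.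
have : v \in [set x; y] by rewrite -Euv set22.
rewrite !inE => /orP[] /eqP Ev /orP[] /eqP Eu; move: nuv; rewrite Eu Ev ?eqxx //.
by rewrite adj_sym.
Qed.

Lemma closure_unique G H :
  joins_to G H -> no_joinable H -> degree_closure G =2 H.
Proof.
move=> GH noH x y; apply/idP/idP.
  exact: joins_to_min (joins_to_closure G) noH (joins_to_sub GH) x y.
exact: joins_to_min GH (@no_joinable_closure G)
  (joins_to_sub (joins_to_closure G)) x y.
Qed.
End Closure.

(* Main.v *)
(** Let [H] be the closure of [G] at level [n + k - 1]. Its vertices of degree at
    least [(n + k - 1) / 2] form a clique; extend it to a maximal clique [C].
    A vertex outside [C] misses some vertex of [C], so its degree in [H] is at
    most [n + k - 1 - #|C|]; counting edges then forces
    [#|C| >= n + k - t - 1]. By [t]-connectivity every degree is at least [t],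
    so either [C] is everything, or there are exactly [t - k + 1] vertices
    outside [C], all of degree [t]. A vertex of [C] with one neighbour outside
    [C] then has degree at least [#|C|], hence by closedness is adjacent to all
    outside vertices. These vertices of [C] form a cut, so there are [t] of
    them, and [H] is the exceptional graph. If [H] is complete, then it is
    [k]-factor-critical, and this property descends along each join of the
    closure by a matching-exchange argument. *)

Require Import Defs.
From mathcomp Require Import all_boot.
From mathcomp Require Import zify.
Set Implicit Arguments.
Unset Strict Implicit.
Unset Printing Implicit Defensive.

(** * Degree sums and edge counts relative to a clique *)

Lemma degreeE (V : finType) (G : sgraph V) (v : V) :
  degree G v = \sum_w G v w.
Proof.
rewrite /degree -sum1_card big_mkcond; apply: eq_bigr => w _.
by rewrite inE; case: (G v w).
Qed.

(** Double counting of edge-endpoint pairs: each edge has two endpoints, and the edges at [x] are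
    all images of neighbours of [x] under [y => [set x; y]]. *)
Lemma double_num_edges_le (V : finType) (G : sgraph V) :
  2 * num_edges G <= \sum_v degree G v.
Proof.
have -> : 2 * num_edges G = \sum_(e in edges G) \sum_x (x \in e).
  rewrite mulnC -sum_nat_const; apply: eq_bigr => e.
  rewrite inE => /existsP[x /existsP[y /andP[Gxy /eqP ->]]].
  have nxy : x != y by apply: contraTneq Gxy => ->; rewrite adj_irr.
  have := cards2 x y; rewrite nxy => <-; rewrite -sum1_card big_mkcond.
  by apply: eq_bigr => z _; case: (z \in _).
rewrite exchange_big; apply: leq_sum => x _.
have -> : \sum_(e in edges G) (x \in e) = #|[set e in edges G | x \in e]|.
  rewrite -sum1_card big_mkcond [RHS]big_mkcond; apply: eq_bigr => e _.
  by rewrite !inE; case: [exists x, _]; case: (x \in e).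
apply: leq_trans (leq_imset_card (fun y => [set x; y]) [set w | G x w]).
apply/subset_leq_card/subsetP => e; rewrite !inE => /andP[].
case/existsP=> u /existsP[v /andP[Guv /eqP ->]].
rewrite !inE => /orP[] /eqP ->; apply/imsetP.
  by exists v; rewrite ?inE.
by exists u; rewrite ?inE 1?adj_sym // setUC.
Qed.

Lemma degree_subrel (V : finType) (G H : sgraph V) (v : V) :
  subrel G H -> degree G v <= degree H v.
Proof.
by move=> GH; apply/subset_leq_card/subsetP => w; rewrite !inE; apply: GH.
Qed.

Lemma num_edges_subrel (V : finType) (G H : sgraph V) :
  subrel G H -> num_edges G <= num_edges H.
Proof.
move=> GH; apply/subset_leq_card/subsetP => e; rewrite !inE.
case/existsP=> x /existsP[y /andP[Gxy e_xy]].
by apply/existsP; exists x; apply/existsP; exists y; rewrite GH.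
Qed.

Definition clique (V : finType) (G : sgraph V) (C : {set V}) : bool :=
  [forall x in C, forall y in C, (x != y) ==> G x y].

Lemma cliqueP (V : finType) (G : sgraph V) (C : {set V}) :
  reflect {in C &, forall x y, x != y -> G x y} (clique G C).
Proof.
apply: (iffP forall_inP) => [Gc x y Cx Cy nxy | Gc x Cx].
  by have /forall_inP/(_ y Cy)/implyP := Gc x Cx; apply.
by apply/forall_inP => y Cy; apply/implyP; apply: Gc.
Qed.

Lemma clique_sum (V : finType) (G : sgraph V) (C : {set V}) (v : V) :
  clique G C -> v \in C -> \sum_(w in C) G v w = #|C|.-1.
Proof.
move=> /cliqueP Gc Cv; rewrite (bigD1 v) //= adj_irr add0n.
rewrite (cardsD1 v) Cv /= -sum1_card; apply: eq_big => w.
  by rewrite !inE andbC.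
by case/andP=> Cw nwv; rewrite Gc // eq_sym.
Qed.

Lemma degree_split (V : finType) (G : sgraph V) (C : {set V}) (v : V) :
  degree G v = \sum_(w in C) G v w + \sum_(w in ~: C) G v w.
Proof.
rewrite degreeE (bigID (mem C)) /=; congr (_ + _).
by apply: eq_bigl => w; rewrite inE.
Qed.

(** In the degree sum, an edge between [C] and its complement is met from both ends. Moving the
    count at its end in [C] to the outer end charges everything beyond the clique to outside
    vertices. *)
Lemma double_num_edges_clique (V : finType) (G : sgraph V) (C : {set V}) :
  clique G C ->
  2 * num_edges G <= #|C| * #|C|.-1
    + \sum_(v in ~: C) (\sum_(w in C) G v w + degree G v).
Proof.
move=> Gc; apply: leq_trans (double_num_edges_le _) _.
rewrite (bigID (mem C)) /= big_split /= addnA leq_add //; last first.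
  by apply: eq_leq; apply: eq_bigl => w; rewrite inE.
rewrite (eq_bigr (fun v => #|C|.-1 + \sum_(w in ~: C) G v w)); last first.
  by move=> v Cv; rewrite (degree_split G C) clique_sum.
rewrite big_split /= sum_nat_const leq_add2l exchange_big /=.
by apply: leq_sum => v _; apply: leq_sum => w _; rewrite adj_sym.
Qed.

Lemma clique_degree (V : finType) (G : sgraph V) (C : {set V}) (v : V) :
  clique G C -> v \in C -> #|C|.-1 <= degree G v.
Proof. by move=> Gc Cv; rewrite (degree_split G C) clique_sum ?leq_addr. Qed.

Lemma clique_degree_ext (V : finType) (G : sgraph V) (C : {set V}) (v w : V) :
  clique G C -> v \in C -> w \notin C -> G v w -> #|C| <= degree G v.
Proof.
move=> Gc Cv nCw Gvw; rewrite (degree_split G C) clique_sum //.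
rewrite [X in _ + X](bigD1 w) ?inE //= Gvw addnA addn1.
by rewrite (leq_trans (leqSpred _)) ?leq_addr.
Qed.

Lemma no_joinableP {V : finType} {l : nat} {G : sgraph V} {x y : V} :
  no_joinable l G -> x != y -> l <= degree G x + degree G y -> G x y.
Proof. by move=> /(_ x y); rewrite /joinable; case: (G x y) => // /[swap] -> /[swap] ->. Qed.

(** * Numerical bounds on the number of edges *)

(* Here [r = #|C|] and [o = n - r]. The bound on [e] is convex in [r], with
   the value of the conclusion at [r = n - d - 2]; it takes that value again at
   [3 * r = n + 2 * k + 3 * d + 5]. *)
Lemma dense_ineq_large (k d n r o e : nat) :
  1 <= k -> r + o = n -> d + 2 <= o -> n + 2 * k + 3 * d + 5 <= 3 * r ->
  2 * e <= r * r.-1 + o * (2 * (o + k - 1)) ->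
  e <= 'C(n - d - 2, 2) + (d + 2) * (k + d + 1).
Proof.
move=> k1 En od r_big eb.
have := mul_bin_left (n - d - 2) 1; rewrite bin1 => binE.
(* Slack variables replace the inequalities by equations, which removes truncated subtraction before
   [nia]. *)
have [a Ea] : exists a, o = d + 2 + a by exists (o - (d + 2)); lia.
have [b Eb] : exists b, 3 * r = n + 2 * k + 3 * d + 5 + b.
  by exists (3 * r - (n + 2 * k + 3 * d + 5)); lia.
have Em : n - d - 2 = r + a by lia.
rewrite Em in binE *.
have [r' Er] : exists r', r = r'.+1 by exists r.-1; lia.
have [k' Ek] : exists k', k = k'.+1 by exists k.-1; lia.
subst; move: eb binE; rewrite addSn !succnK => eb binE.
nia.
Qed.

(* For the remaining, small cliques the bound on [e] is increasing in [r]. *)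
Lemma dense_ineq_small (k d n r o e : nat) :
  1 <= k -> 0 < r -> r + o = n -> 4 * k + 15 * d + 29 <= 2 * n ->
  3 * r < n + 2 * k + 3 * d + 5 ->
  4 * e <= 2 * (r * r.-1) + o * (2 * r.-1 + (n + k - 2)) ->
  e <= 'C(n - d - 2, 2) + (d + 2) * (k + d + 1).
Proof.
move=> k1 r0 En n_big r_small eb.
(* The terms in [r * r] cancel, so the bound on [4 * e] is affine in [r], with slope [n - k + 2]. *)
have r_up : 4 * e + 4 * n + (n + k) * r <= 2 * (n * r) + n * (n + k) + 2 * r.
  have [p Ep] : exists p, n + k = p + 2 by exists (n + k - 2); lia.
  rewrite Ep addnK in eb *.
  by case: r r0 En eb {r_small} => [//|r] _ En; rewrite succnK => eb; subst n; lia.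
(* The positive slope allows [3 * r] to be replaced by its largest value [n + 2 * k + 3 * d + 4]. *)
have n_up : 12 * e + 12 * n + (n + 2 * k + 3 * d + 4) * k
    <= (n + 2 * k + 3 * d + 4) * (n + 2) + 3 * n * (n + k).
  have [b Eb] : exists b, n = k + b by exists (n - k); lia.
  have : 3 * r * (b + 2) <= (n + 2 * k + 3 * d + 4) * (b + 2).
    by rewrite leq_mul2r; lia.
  by move: r_up; rewrite Eb; lia.
have [m Em] : exists m, n = m + d + 3 by exists (n - d - 3); lia.
have [c Ec] : exists c, 2 * n = 4 * k + 15 * d + 29 + c.
  by exists (2 * n - (4 * k + 15 * d + 29)); lia.
(* Since [lia] treats products as atoms, the lower bound on [n] is multiplied by [n] here, and the
   signs of the other monomials are supplied below. *)
have E2 : 2 * n * n = (4 * k + 15 * d + 29 + c) * n by rewrite Ec.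
have := mul_bin_left (n - d - 2) 1.
have -> : n - d - 2 = m.+1 by lia.
rewrite bin1 subn1 succnK => binE.
rewrite -(leq_pmul2l (isT : 0 < 12)).
have := leq0n (c * m); have := leq0n (c * d); have := leq0n (d * k).
have := leq0n (k * k); have := leq0n (d * d); have := leq0n (d * m).
have := leq0n (k * m).
by clear - n_up Em Ec E2 binE; subst n; lia.
Qed.

(** * Large cliques in closed dense graphs *)

Lemma maximal_clique (V : finType) (G : sgraph V) (B : {set V}) :
  clique G B -> exists C : {set V}, [/\ clique G C, B \subset C &
    forall v, v \notin C -> exists2 w, w \in C & ~~ G v w].
Proof.
case/maxset_exists => C /maxsetP[Gc Cmax] BC; exists C; split=> // v nCv.
apply/exists_inP; apply: contraNT nCv => /exists_inPn Gv.
rewrite -(Cmax (v |: C)) ?setU11 ?subsetU1 //.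
apply/cliqueP => x y; rewrite !inE => /orP[/eqP->|Cx] /orP[/eqP->|Cy].
- by rewrite eqxx.
- by have := Gv y Cy; rewrite negbK.
- by have := Gv x Cx; rewrite negbK adj_sym.
- exact: (cliqueP _ _ Gc).
Qed.

Lemma closed_clique_degree (V : finType) (n k : nat) (G : sgraph V) (C : {set V})
    (v w : V) :
  #|V| = n -> 1 <= k -> no_joinable (n + k - 1) G -> clique G C ->
  v \notin C -> w \in C -> ~~ G v w -> degree G v + 1 <= #|~: C| + k.
Proof.
move=> Vn k1 Gcl Gc nCv Cw nGvw; have dw := clique_degree Gc Cw.
have nvw : v != w by apply: contraNneq nCv => ->.
have : degree G v + degree G w < n + k - 1.
  by rewrite ltnNge; apply: contra nGvw; apply: no_joinableP.
have := cardsC C; rewrite Vn; have : 0 < #|C| by apply/card_gt0P; exists w.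
move: dw; clear; lia.
Qed.

(** Here [d] stands for [t - k]. With [d + 2] or more vertices outside a maximal clique containing
    all vertices of high degree, the edge count would be too small. *)
Lemma closed_dense_clique (V : finType) (n k d : nat) (G : sgraph V) :
  #|V| = n -> 1 <= k -> 4 * k + 15 * d + 29 <= 2 * n ->
  no_joinable (n + k - 1) G ->
  'C(n - d - 2, 2) + (d + 2) * (k + d + 1) < num_edges G ->
  exists C : {set V}, [/\ clique G C, #|~: C| <= d + 1 &
    forall v, v \notin C -> exists2 w, w \in C & ~~ G v w].
Proof.
move=> Vn k1 n_big Gcl eG.
have /maximal_clique[C [Gc bigC Cmax]] :
    clique G [set v | n + k - 1 <= 2 * degree G v].
  apply/cliqueP => x y; rewrite !inE => dx dy nxy.
  by apply: (no_joinableP Gcl nxy); lia.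
exists C; split=> //; rewrite leqNgt; apply: contraL eG => o_big.
rewrite -leqNgt; have := cardsC C; rewrite Vn => En.
have C0 : 0 < #|C|.
  case: (posnP #|C|) => // /eqP; rewrite cards_eq0 => /eqP E.
  have /card_gt0P[v _] : 0 < #|V| by rewrite Vn; lia.
  by case: (Cmax v) => [|w]; rewrite E inE.
have inC v : v \notin C -> \sum_(w in C) G v w <= #|C|.-1.
  case/Cmax=> w Cw nGvw; rewrite (bigD1 w) //= (negbTE nGvw) add0n.
  have -> : #|C|.-1 = \sum_(i in C | i != w) 1.
    rewrite (cardsD1 w) Cw add1n succnK -sum1_card.
    by apply: eq_bigl => i; rewrite !inE andbC.
  by apply: leq_sum => i _; apply: leq_b1.
have eub := double_num_edges_clique Gc.
(* An outside vertex contributes its degree plus its number of neighbours in [C]. For large [C],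
   both are bounded by [#|~: C| + k - 1]. For small [C], the degree is below half the closure level,
   as [bigC] puts the other vertices in [C], and at most [#|C|.-1] neighbours lie in [C]. *)
case: (leqP (n + 2 * k + 3 * d + 5) (3 * #|C|)) => r_cmp.
- apply: (dense_ineq_large k1 En _ r_cmp); first by lia.
  apply: leq_trans eub _; rewrite leq_add2l -sum_nat_const.
  apply: leq_sum => v; rewrite inE => nCv; have [w Cw nGvw] := Cmax v nCv.
  have := closed_clique_degree Vn k1 Gcl Gc nCv Cw nGvw.
  have := degree_split G C v; clear; lia.
- apply: (dense_ineq_small k1 C0 En n_big r_cmp).
  rewrite -[4]/(2 * 2) -mulnA.
  apply: leq_trans (leq_mul (leqnn 2) eub) _.
  rewrite mulnDr leq_add2l -sum_nat_const big_distrr /=.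
  apply: leq_sum => v; rewrite inE => nCv.
  have : degree G v * 2 < n + k - 1.
    rewrite ltnNge mulnC; apply: contra nCv => dv.
    by apply: (subsetP bigC); rewrite inE.
  by rewrite mulnDr => dv; rewrite leq_add ?leq_mul2l ?inC //; move: dv; clear; lia.
Qed.

(** * Vertex cuts and minimum degree *)

(** A path from [x] to [y] avoiding [S] has a first edge that leaves [X]. *)
Lemma t_connected_cut (V : finType) (t : nat) (G : sgraph V) (S X : {set V})
    (x y : V) :
  t_connected t G -> #|S| < t -> x \in X -> x \notin S -> y \notin X ->
  y \notin S -> exists u v, [/\ u \in X, v \notin X, v \notin S & G u v].
Proof.
move=> [_ _ Gt] /Gt[_ conS] Xx nSx nXy nSy.
have path_cut (p : seq {z | z \notin S}) (z : {z | z \notin S}) :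
    path (delete G S) z p -> val z \in X -> val (last z p) \notin X ->
    exists u v, [/\ u \in X, v \notin X, v \notin S & G u v].
  elim: p z => [|z' p IHp] z /=; first by move=> _ ->.
  case/andP=> Gzz' pz' Xz nXl; case: (boolP (val z' \in X)) => [Xz'|nXz'].
    exact: IHp pz' Xz' nXl.
  by exists (val z), (val z'); split=> //; apply: (valP z').
have /connectP[p pxp Ey] := conS (Sub x nSx) (Sub y nSy).
by apply: (path_cut p _ pxp); rewrite -?Ey.
Qed.

(** A neighbourhood of fewer than [t] vertices would be a cut separating [v] from some further
    vertex [y]. *)
Lemma t_connected_degree (V : finType) (t : nat) (G : sgraph V) (v : V) :
  t_connected t G -> t <= degree G v.
Proof.
move=> Gt; rewrite leqNgt; apply/negP => dv; have [_ t_lt _] := Gt.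
have nNv : v \notin [set w | G v w] by rewrite inE adj_irr.
have [y] : exists y, y \notin v |: [set w | G v w].
  apply/existsP; rewrite -[[exists _, _]]negbK negb_exists.
  apply: contraL t_lt => /forallP allN; rewrite -leqNgt -cardsT.
  have -> : [set: V] = v |: [set w | G v w].
    by apply/setP => y; rewrite inE; have := allN y; rewrite negbK => ->.
  by rewrite cardsU1 nNv.
rewrite in_setU1 negb_or => /andP[nyv nNy].
have [||u [w [/set1P-> _]]] := t_connected_cut (y := y) Gt dv (set11 v) nNv.
- by rewrite inE.
- exact: nNy.
- by rewrite inE => /negP.
Qed.

(** * The exceptional graph *)

Lemma rank_in (V : finType) (A : {set V}) (m : nat) :
  0 < m -> #|A| = m -> exists g : V -> 'I_m, {in A &, injective g}.
Proof.
move=> m0 Am; have /card_gt0P[a Aa] : 0 < #|A| by rewrite Am.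
exists (fun x => cast_ord Am (enum_rank_in Aa x)) => x y Ax Ay /cast_ord_inj.
exact: enum_rank_in_inj.
Qed.

(** Adjacency of distinct vertices depends only on which of [A], [C :\: A] and [~: C] contain them,
    so the three parts can be numbered independently. As [A] lies in [C], the set [~: C] is
    independent. *)
Lemma split_graph_isomorphic (V : finType) (t m s : nat) (H : sgraph V)
    (A C : {set V}) :
  0 < t -> 0 < m -> 0 < s -> A \subset C -> clique H C ->
  {in ~: C, forall u v, H u v = (v \in A)} ->
  #|A| = t -> #|C :\: A| = m -> #|~: C| = s ->
  isomorphic H (graph_join (complete t)
    (disjoint_union (complete m) (copies s (complete 1)))).
Proof.
move=> t0 m0 s0 AC /cliqueP Hc Ho At Cm Os.
have [ga gaI] := rank_in t0 At; have [gc gcI] := rank_in m0 Cm.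
have [go goI] := rank_in s0 Os.
pose f x : 'I_t + ('I_m + 'I_s * 'I_1) :=
  if x \in A then inl (ga x)
  else if x \in C then inr (inl (gc x)) else inr (inr (go x, ord0)).
have HC x y : x \in C -> y \in C -> H x y = (x != y).
  move=> Cx Cy; case: eqVneq => [->|]; [exact: adj_irr | exact: Hc].
have AinC x : x \in A -> x \in C by apply: (subsetP AC).
exists f.
  apply: inj_card_bij => [x y|].
    rewrite /f; case: (boolP (x \in A)) => Ax; case: (boolP (y \in A)) => Ay.
    - by case=> /gaI; apply.
    - by case: ifP.
    - by case: ifP.
    - case: (boolP (x \in C)) => Cx; case: (boolP (y \in C)) => Cy //; case.
        by move=> /gcI; apply; rewrite inE ?Ax ?Ay.
      by move=> /goI; apply; rewrite inE.
  rewrite !card_sum card_prod !card_ord muln1 -At -Cm -Os addnA.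
  by rewrite -(cardsC C) leq_add2r -(cardsID A C) (setIidPr AC).
move=> x y; rewrite /f.
case: (boolP (x \in C)) => Cx; case: (boolP (y \in C)) => Cy.
- rewrite HC //.
  case: (boolP (x \in A)) => Ax; case: (boolP (y \in A)) => Ay /=.
  + by rewrite /complete_rel (inj_in_eq gaI).
  + by apply/esym; apply: contraNneq Ay => <-.
  + by apply/esym; apply: contraNneq Ax => ->.
  + by rewrite /complete_rel (inj_in_eq gcI) // inE ?Ax ?Ay.
- have /negbTE -> : y \notin A by apply: contra Cy; apply: AinC.
  by rewrite [H x y]adj_sym Ho ?inE //; case: ifP.
- have /negbTE -> : x \notin A by apply: contra Cx; apply: AinC.
  by rewrite Ho ?inE //; case: ifP.
- have /negbTE nAx : x \notin A by apply: contra Cx; apply: AinC.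
  have /negbTE nAy : y \notin A by apply: contra Cy; apply: AinC.
  by rewrite nAx nAy Ho ?inE // nAy /= /copies_rel /= /complete_rel eqxx andbF.
Qed.

Lemma closed_dense_structure (V : finType) (n t k : nat) (G H : sgraph V) :
  #|V| = n -> 1 <= k <= t -> 15 * t - 11 * k + 29 <= 2 * n -> t_connected t G ->
  subrel G H -> no_joinable (n + k - 1) H ->
  'C(n + k - t - 2, 2) + (t - k + 2) * (t + 1) < num_edges H ->
  clique H [set: V] \/
  isomorphic H (graph_join (complete t)
    (disjoint_union (complete (n + k - 2 * t - 1))
                    (copies (t - k + 1) (complete 1)))).
Proof.
move=> Vn /andP[k1 kt] n_big Gt GH Hcl eH.
have [d Ed] : exists d, t = k + d by exists (t - k); lia.
have Ed' : t - k = d by lia.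
have [||C [Hc o_le Cmax]] := @closed_dense_clique V n k d H Vn k1 _ Hcl.
- by lia.
- have <- : n + k - t - 2 = n - d - 2 by lia.
  by rewrite -Ed -Ed'.
have tH v : t <= degree H v.
  exact: leq_trans (t_connected_degree v Gt) (degree_subrel v GH).
have outH v : v \notin C -> degree H v + 1 <= #|~: C| + k.
  by move=> nCv; have [w Cw] := Cmax v nCv; apply: (closed_clique_degree Vn k1 Hcl).
have [C_full|[x0]] := set_0Vmem (~: C).
  by left; rewrite -(setCK C) C_full setC0 in Hc.
rewrite inE => nCx0; right.
(* The bounds [t <= degree H x0] and [degree H x0 + 1 <= #|~: C| + k] force [d + 1] outside
   vertices. *)
have o_eq : #|~: C| = d + 1 by have := tH x0; have := outH x0 nCx0; lia.
have degO v : v \notin C -> degree H v = t.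
  by move=> nCv; have := tH v; have := outH v nCv; lia.
have := cardsC C; rewrite Vn => En.
pose A := [set w in C | [exists v, (v \notin C) && H w v]].
have AC : A \subset C by apply/subsetP => w; rewrite inE => /andP[].
(* The degrees are at least [#|C| = n - d - 1] and exactly [t = k + d]; their sum just reaches
   [n + k - 1]. *)
have AO w v : w \in A -> v \notin C -> H w v.
  rewrite inE => /andP[Cw /existsP[u /andP[nCu Hwu]]] nCv.
  apply: (no_joinableP Hcl); first by apply: contraNneq nCv => <-.
  by have := clique_degree_ext Hc Cw nCu Hwu; rewrite (degO v nCv); lia.
(* Otherwise removing [A] leaves an edge of [G] from [~: C] to [C :\: A], against the definition of
   [A]. *)
have At_ge : t <= #|A|.
  rewrite leqNgt; apply/negP => At.
  have [y Cy nAy] : exists2 y, y \in C & y \notin A.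
    by apply/subsetPn; apply: contraTN At => /subset_leq_card; lia.
  have nAx0 : x0 \notin A by apply: contra nCx0; apply: (subsetP AC).
  have [||u [v [Ou nOv nAv Guv]]] :=
    t_connected_cut (X := ~: C) (x := x0) (y := y) Gt At _ nAx0 _ nAy.
  - by rewrite inE.
  - by rewrite inE negbK.
  rewrite !inE ?negbK in Ou nOv nAv; move/negP: nAv; apply; rewrite nOv.
  by apply/existsP; exists u; rewrite Ou adj_sym GH.
have NO u : u \notin C -> A = [set w | H u w].
  move=> nCu; apply/eqP; rewrite eqEcard; apply/andP; split.
    by apply/subsetP => w Aw; rewrite inE adj_sym AO.
  by rewrite -/(degree H u) degO.
have At : #|A| = t by rewrite (NO x0 nCx0) -/(degree H x0) degO.
apply: (@split_graph_isomorphic _ _ _ _ _ A C) => //; try lia.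
- by move=> u; rewrite inE => nCu v; rewrite (NO u nCu) inE.
- by rewrite cardsD (setIidPr AC) At; lia.
Qed.

(** * Matchings and their descent along the closure *)

(* A perfect matching of [G - S] is encoded as a fixed-point-free involution on
   the complement of [S]; the values of [f] on [S] are junk. *)
Definition matched_outside (V : finType) (G : sgraph V) (S : {set V}) : Prop :=
  exists f : V -> V,
    forall x, x \notin S -> [/\ f x \notin S, f (f x) = x & G x (f x)].

(** The matching edges are the orbits of the involution. *)
Lemma matched_outside_factor_critical (V : finType) (k : nat) (G : sgraph V) :
  (forall S : {set V}, #|S| = k -> matched_outside G S) -> factor_critical k G.
Proof.
move=> mG S /mG[f fP].
pose g (x : {x | x \notin S}) : {x | x \notin S} := insubd x (f (val x)).
have val_g x : val (g x) = f (val x).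
  by rewrite val_insubd; have [-> _ _] := fP _ (valP x).
have gK x : g (g x) = x.
  by apply: val_inj; rewrite !val_g; have [_ -> _] := fP _ (valP x).
have Gg x : delete G S x (g x).
  by rewrite /= /delete_rel val_g; have [_ _] := fP _ (valP x).
pose E x := [set x; g x].
have Eg x y : y \in E x -> E y = E x.
  by rewrite !inE => /orP[]/eqP->; rewrite // /E gK setUC.
exists (E @: setT); apply/andP; split.
  apply/subsetP => _ /imsetP[x _ ->]; rewrite inE.
  by apply/existsP; exists x; apply/existsP; exists (g x); rewrite Gg eqxx.
apply/and3P; split.
- rewrite eqEsubset subsetT; apply/subsetP => x _; apply/bigcupP.
  by exists (E x); rewrite ?imset_f ?inE ?eqxx.
- apply/trivIsetP => _ _ /imsetP[x _ ->] /imsetP[y _ ->].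
  apply: contraR => /pred0Pn[z /andP[/= zx zy]].
  by rewrite -(Eg _ _ zx) (Eg _ _ zy).
- by apply/imsetP => -[x _ /setP/(_ x)]; rewrite !inE eqxx.
Qed.

Lemma complete_matched_outside (V : finType) (G : sgraph V) (S : {set V}) :
  clique G [set: V] -> ~~ odd #|~: S| -> matched_outside G S.
Proof.
move=> /cliqueP Gc evS; pose s := enum (~: S).
have s_ev : ~~ odd (size s) by rewrite -cardE.
(* [h] swaps positions [2j] and [2j + 1] of the enumeration; even length keeps it within range. *)
pose h i := if odd i then i.-1 else i.+1.
have hK i : h (h i) = i.
  rewrite /h; case: (boolP (odd i)) => [|/negbTE oi]; last by rewrite /= oi.
  by case: i => [//|j] /= /negbTE ->.
have h_lt i : i < size s -> h i < size s.
  rewrite /h; case: ifP => oi lt_is; first exact: leq_ltn_trans (leq_pred i) _.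
  by rewrite ltn_neqAle lt_is andbT; apply: contraNneq s_ev => <-; rewrite /= oi.
exists (fun x => nth x s (h (index x s))) => x nSx.
have sx : x \in s by rewrite mem_enum inE.
have ix : h (index x s) < size s by rewrite h_lt // index_mem.
have Sy : nth x s (h (index x s)) \in s by rewrite mem_nth.
split.
- by rewrite mem_enum inE in Sy.
- by rewrite index_uniq ?enum_uniq // hK (set_nth_default x) ?index_mem ?nth_index.
- apply: Gc; rewrite ?inE //; apply/eqP => E.
  have : index x s = h (index x s) by rewrite {1}E index_uniq ?enum_uniq.
  by rewrite /h; case: ifP => [|_ /n_Sn //]; case: (index x s) => // j _ /esym/n_Sn.
Qed.

Lemma add_edge_matched_outside (V : finType) (k : nat) (G : sgraph V) (x y : V)
    (S : {set V}) :
  joinable (#|V| + k - 1) G x y -> #|S| = k ->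
  matched_outside (add_edge G x y) S -> matched_outside G S.
Proof.
case/and3P=> nxy nGxy dxy Sk [f fP].
have fN u : u \notin S -> f u \notin S by case/fP.
have fK u : u \notin S -> f (f u) = u by case/fP.
have Gf u : u \notin S -> G u (f u) \/ (u == x) && (f u == y) || (u == y) && (f u == x).
  case/fP=> _ _ /= /orP[|/andP[nuf /eqP E]]; [by left | right].
  have : u \in [set x; y] by rewrite -E set21.
  have : f u \in [set x; y] by rewrite -E set22.
  rewrite !inE => /orP[]/eqP Ef /orP[]/eqP Eu; rewrite Ef Eu !eqxx ?orbT //;
    by rewrite Ef Eu eqxx in nuf.
(* If [f] does not pair [x] with [y], it already uses only edges of [G]. *)
have [/andP[nSx /eqP fx]|unmatched] := boolP ((x \notin S) && (f x == y)); last first.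
  exists f => u nSu; split; [exact: fN | exact: fK |].
  case: (Gf u nSu) => // /orP[] /andP[/eqP Eu /eqP Ef].
    by case/negP: unmatched; rewrite -Eu nSu Ef eqxx.
  by case/negP: unmatched; rewrite -{1}Ef fN // -Ef fK // Eu eqxx.
have nSy : y \notin S by rewrite -fx fN.
have fy : f y = x by rewrite -fx fK.
pose T := ~: (S :|: [set x; y]).
pose A := [set u in T | G x u]; pose B := [set u in T | G y (f u)].
have fT u : u \in T -> f u \in T.
  rewrite !inE !negb_or => /andP[nSu /andP[nux nuy]]; rewrite fN //=.
  apply/andP; split; [apply: contraNneq nuy | apply: contraNneq nux] => E.
    by rewrite -fx -E fK.
  by rewrite -fy -E fK.
have fTK : {in T, cancel f f} by move=> u; rewrite !inE negb_or => /andP[/fK].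
(* Neighbours of [z] lie in [S], which has [k] elements, or in [T]. *)
have deg_le z : G z x = false -> G z y = false ->
    degree G z <= k + #|[set u in T | G z u]|.
  move=> nGx nGy; rewrite -Sk; apply: leq_trans (leq_card_setU _ _).1.
  apply/subset_leq_card/subsetP => u; rewrite !inE => Gzu.
  case: (u \in S) => //=; rewrite Gzu andbT.
  by apply/norP; split; apply: contraTneq Gzu => ->; rewrite ?nGx ?nGy.
have dx : degree G x <= k + #|A|.
  by apply: deg_le; rewrite ?adj_irr ?(negbTE nGxy).
have dy : degree G y <= k + #|B|.
  (* [f] permutes [T], so it maps [B] bijectively onto the neighbours of [y] in [T]. *)
  have -> : #|B| = #|[set u in T | G y u]|.
    rewrite -(@card_in_imset _ _ f B) => [|u v]; last first.
      move=> /setIdP[Tu _] /setIdP[Tv _] E.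
      by rewrite -(fTK u Tu) E fTK.
    apply: eq_card => u.
    apply/imsetP/idP => [[v /setIdP[Tv Gv] ->]|/setIdP[Tu Gu]].
      by apply/setIdP; split; first exact: fT.
    by exists (f u); rewrite ?fTK //; apply/setIdP; rewrite fT // fTK.
  by apply: deg_le; rewrite ?adj_irr // adj_sym (negbTE nGxy).
have cT : #|T| + (k + 2) = #|V|.
  rewrite -(cardsC T) setCK cardsU Sk cards2 nxy.
  suff -> : S :&: [set x; y] = set0 by rewrite cards0 subn0.
  apply/setP => u; rewrite !inE; apply/andP => -[Su /orP[]/eqP E].
    by rewrite -E Su in nSx.
  by rewrite -E Su in nSy.
(* [A] and [B] lie in [T], which has [#|V| - k - 2] elements, while the degree
   condition gives [#|A| + #|B| >= #|V| - k - 1]. A common element [u] lets us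
   replace the edges [xy] and [u (f u)] by [xu] and [y (f u)]. *)
have /set0Pn[u] : A :&: B != set0.
  rewrite -card_gt0; have := cardsUI A B.
  have : #|A :|: B| <= #|T|.
    by apply/subset_leq_card/subsetP => u /setUP[]; rewrite inE => /andP[].
  move: dxy dx dy cT; clear; move: #|V| #|T| #|A| #|B| #|A :|: B| #|A :&: B|.
  by lia.
case/setIP=> /setIdP[Tu Gxu] /setIdP[_ Gyfu].
have := fT u Tu; have := Tu; rewrite !inE !negb_or.
case/and3P=> nSu nux nuy /and3P[nSfu nfux nfuy].
pose g z := if z == x then u else if z == u then x else
            if z == y then f u else if z == f u then y else f z.
have fuu : u != f u.
  have := Gf u nSu; rewrite (negbTE nux) (negbTE nuy) => -[Guu|//].
  by apply: contraTneq Guu => <-; rewrite adj_irr.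
have nyx : y != x by rewrite eq_sym.
have nyu : y != u by rewrite eq_sym.
have gx : g x = u by rewrite /g eqxx.
have gu : g u = x by rewrite /g (negbTE nux) eqxx.
have gy : g y = f u by rewrite /g (negbTE nyx) (negbTE nyu) eqxx.
have gfu : g (f u) = y.
  by rewrite /g (negbTE nfux) [f u == u]eq_sym (negbTE fuu) (negbTE nfuy) eqxx.
exists g => z nSz.
have [->|nzx] := eqVneq z x; first by rewrite gx gu.
have [->|nzu] := eqVneq z u; first by rewrite gu gx adj_sym.
have [->|nzy] := eqVneq z y; first by rewrite gy gfu.
have [->|nzfu] := eqVneq z (f u); first by rewrite gfu gy adj_sym.
have g_other w : w != x -> w != u -> w != y -> w != f u -> g w = f w.
  by rewrite /g => /negbTE-> /negbTE-> /negbTE-> /negbTE->.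
have fz_neq w : f w != z -> w \notin S -> f z != w.
  by move=> nfwz nSw; apply: contraNneq nfwz => <-; rewrite fK.
rewrite g_other //; split; first exact: fN.
  by rewrite g_other ?fK // fz_neq ?fx ?fy ?fK // eq_sym.
by case: (Gf z nSz) => //; rewrite (negbTE nzx) (negbTE nzy).
Qed.

Lemma joins_to_matched_outside (V : finType) (k : nat) (G H : sgraph V)
    (S : {set V}) :
  joins_to (#|V| + k - 1) G H -> #|S| = k ->
  matched_outside H S -> matched_outside G S.
Proof.
move=> GH Sk; elim: GH => [//|{}G x y {}H Gxy _ IH] /IH.
exact: add_edge_matched_outside Gxy Sk.
Qed.

Theorem theorem1p7 (t k n : nat) (V : finType) (G : sgraph V)
  (k_ge1 : 1 <= k) (t_gek : k <= t)
  (Gconn : t_connected t G)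
  (orderG : #|V| = n)
  (n_large : 15 * t - 11 * k + 29 <= 2 * n)
  (n_parity : n = k %[mod 2])
  (eG : num_edges G > 'C(n + k - t - 2, 2) + (t - k + 2) * (t + 1)) :
  factor_critical k G \/
  isomorphic (degree_closure (n + k - 1) G)
    (graph_join (complete t)
       (disjoint_union (complete (n + k - 2 * t - 1))
                       (copies (t - k + 1) (complete 1)))).
Proof.
have GH := joins_to_closure (n + k - 1) G.
have GsubH := joins_to_sub GH.
have eH := leq_trans eG (num_edges_subrel GsubH).
have k_range : 1 <= k <= t by rewrite k_ge1.
have [Hc|] := closed_dense_structure orderG k_range n_large Gconn GsubH
  (@no_joinable_closure V (n + k - 1) G) eH; last by right.
left; apply: matched_outside_factor_critical => S Sk.
rewrite -orderG in GH Hc; apply: (joins_to_matched_outside GH Sk).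
apply: complete_matched_outside Hc _.
by have := cardsC S; rewrite Sk orderG; move: n_parity; clear; lia.
Qed.
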